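(* Let $v$ be a framing rank on $\mathcal A$, let $Z$ be a $v$-compatible stability function on $\mathcal A$ such that $Z_c=Z-cv$ has the Harder–Narasimhan property for every $c\in\mathbb R$. Let $c\in\mathbb R$ and let $E\in\mathcal A$ be an object with $v(E)=1$. The following conditions are equivalent: (1) $E$ is $c$-semistable. (2) The HN filtration of $E$ with respect to $c^-$ has the form $E'\subset E$ (that is, $0\subset E'\subset E$, with $E'=0$ allowed, in which case the filtration is the one-step filtration $0\subset E$), where $v(E')=0$ and, if $E'\neq0$, $E'$ and $E$ have equal $c$-slopes: $\mu_c(E')=\mu_c(E)$. (3) The HN filtration of $E$ with respect to $c^+$ has the form $E'\subset E$ (that is, $0\subset E'\subset E$, with $E'=E$ allowed, in which case the filtration is the one-step filtration $0\subset E$), where $v(E')=1$ and $E'$ and $E$ have equal $c$-slopes: $\mu_c(E')=\mu_c(E)$.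
   Context: $\mathcal A$ is an abelian category, $\Gamma$ a free finitely generated abelian group, $\mathrm{cl}:K_0(\mathcal A)\to\Gamma$ a fixed group homomorphism. For a homomorphism $f$ out of $\Gamma$ and $E\in\mathcal A$ write $f(E)=f(\mathrm{cl}\,E)$. A stability function is a group homomorphism $Z:\Gamma\to\mathbb C$ with $Z(E)\in\{re^{i\pi\varphi}: r>0,\ \varphi\in(0,1]\}$ for every nonzero $E\in\mathcal A$; write $Z=-d+ir$ with $d,r:\Gamma\to\mathbb R$ homomorphisms, and let $\mu(E)=d(E)/r(E)\in(-\infty,\infty]$ be the slope (equal to $+\infty$ if $r(E)=0$). A nonzero object $E$ is $Z$-semistable (resp. $Z$-stable) if $\mu(F)\le\mu(E)$ (resp. $\mu(F)<\mu(E)$) for every subobject $0\ne F\subsetneq E$. $Z$ has the Harder–Narasimhan (HN) property if every object $E$ has a finite filtration $0=E_0\subset\dots\subset E_n=E$ with $E_i/E_{i-1}$ semistable and $\mu(E_1/E_0)>\dots>\mu(E_n/E_{n-1})$ (such a filtration is unique and called the HN filtration). $\Gamma_+\subset\Gamma$ is the semigroup generated by the classes $\mathrm{cl}\,E$, $E\in\mathcal A$; put $\alpha\le\beta$ if $\beta-\alpha\in\Gamma_+$. Standing assumption: for every $\alpha\in\Gamma_+$ there are only finitely many $\beta$ with $0<\beta<\alpha$. A framing rank is a group homomorphism $v:\Gamma\to\mathbb Z$ with $v(E)\ge0$ for all $E\in\mathcal A$. A stability function $Z=-d+ir$ is $v$-compatible if $r(E)=0$ implies $v(E)=0$. For $c\in\mathbb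 R$, $Z_c=Z-cv$ is a stability function with slope $\mu_c(E)=\frac{d(E)+cv(E)}{r(E)}$. ''$c$-(semi)stable'' means (semi)stable with respect to $Z_c$. A property holds with respect to $c^+$ (resp. $c^-$) if it holds with respect to $Z_{c+\varepsilon}$ (resp. $Z_{c-\varepsilon}$) for all sufficiently small $\varepsilon>0$; in particular the HN filtration with respect to $c^\pm$ is the HN filtration with respect to $Z_{c\pm\varepsilon}$ for $0<\varepsilon\ll1$. *)

(* Defs.v *)
From HB Require Import structures.
From mathcomp Require Import all_boot all_order all_algebra.
From mathcomp Require Import generic_quotient.
From mathcomp Require Import all_classical all_reals all_analysis.
From mathcomp Require Import complex.

Set Implicit Arguments.
Unset Strict Implicit.
Unset Printing Implicit Defensive.

Import Order.TTheory GRing.Theory Num.Theory.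
Import numFieldNormedType.Exports.

Local Open Scope classical_set_scope.
Local Open Scope ring_scope.
Local Open Scope quotient_scope.

Record preadditive_category := Preadditive {
  ob :> Type;
  mor : ob -> ob -> zmodType;
  idm : forall X, mor X X;
  compm : forall X Y Z, mor Y Z -> mor X Y -> mor X Z;
  comp1m : forall X Y (f : mor X Y), compm (idm Y) f = f;
  compm1 : forall X Y (f : mor X Y), compm f (idm X) = f;
  compA : forall W X Y Z (h : mor Y Z) (g : mor X Y) (f : mor W X),
    compm h (compm g f) = compm (compm h g) f;
  compDl : forall X Y Z (g g' : mor Y Z) (f : mor X Y),
    compm (g + g') f = compm g f + compm g' f;
  compDr : forall X Y Z (g : mor Y Z) (f f' : mor X Y),
    compm g (f + f') = compm g f + compm g f'
}.

Arguments mor {p} X Y.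
Arguments idm {p} X.
Arguments compm {p X Y Z} g f.

Notation "g \oc f" := (compm g f) (at level 40, left associativity).

Section Morphisms.
Variable A : preadditive_category.
Implicit Types X Y Z : A.

Definition is_zero X :=
  forall Y, (exists! f : mor X Y, True) /\ (exists! f : mor Y X, True).

Definition is_mono X Y (f : mor X Y) :=
  forall W (g h : mor W X), f \oc g = f \oc h -> g = h.

Definition is_epi X Y (f : mor X Y) :=
  forall Z (g h : mor Y Z), g \oc f = h \oc f -> g = h.

Definition is_iso X Y (f : mor X Y) :=
  exists g : mor Y X, g \oc f = idm X /\ f \oc g = idm Y.

Definition is_kernel K X Y (k : mor K X) (f : mor X Y) :=
  f \oc k = 0 /\
  forall W (g : mor W X), f \oc g = 0 -> exists! h : mor W K, k \oc h = g.

Definition is_cokernel X Y Q (f : mor X Y) (q : mor Y Q) :=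
  q \oc f = 0 /\
  forall Z (g : mor Y Z), g \oc f = 0 -> exists! h : mor Q Z, h \oc q = g.

Definition is_biproduct X Y P
    (i1 : mor X P) (i2 : mor Y P) (p1 : mor P X) (p2 : mor P Y) :=
  [/\ p1 \oc i1 = idm X, p2 \oc i2 = idm Y, p1 \oc i2 = 0, p2 \oc i1 = 0
    & i1 \oc p1 + i2 \oc p2 = idm P].

(* The sequence 0 -> X -> Y -> Z -> 0 is exact. *)
Definition is_ses X Y Z (i : mor X Y) (p : mor Y Z) :=
  is_kernel i p /\ is_cokernel i p.

End Morphisms.

Record abelian_category := Abelian {
  ab_preadditive :> preadditive_category;
  zero_ob : ab_preadditive;
  zero_obP : is_zero zero_ob;
  has_biproducts : forall X Y : ab_preadditive, exists (P : ab_preadditive)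
    (i1 : mor X P) (i2 : mor Y P) (p1 : mor P X) (p2 : mor P Y),
    is_biproduct i1 i2 p1 p2;
  has_kernels : forall (X Y : ab_preadditive) (f : mor X Y),
    exists (K : ab_preadditive) (k : mor K X), is_kernel k f;
  has_cokernels : forall (X Y : ab_preadditive) (f : mor X Y),
    exists (Q : ab_preadditive) (q : mor Y Q), is_cokernel f q;
  mono_normal : forall (X Y : ab_preadditive) (f : mor X Y), is_mono f ->
    exists (Z : ab_preadditive) (g : mor Y Z), is_kernel f g;
  epi_conormal : forall (X Y : ab_preadditive) (f : mor X Y), is_epi f ->
    exists (W : ab_preadditive) (g : mor W X), is_cokernel g f
}.

Arguments zero_ob A : rename.

(* K0 A is the abelian group presented by generators [E] for E in A and
   relations [Y] = [X] + [Z] for the short exact sequences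
   0 -> X -> Y -> Z -> 0: formal expressions in the generators, modulo the
   congruence K0_rel generated by the group axioms and these relations. *)
Inductive K0_word (A : abelian_category) : Type :=
| K0_gen of A
| K0_word0
| K0_wordN of K0_word A
| K0_wordD of K0_word A & K0_word A.

Arguments K0_word0 {A}.

Inductive K0_rel (A : abelian_category) : K0_word A -> K0_word A -> Prop :=
| K0_refl x : K0_rel x x
| K0_sym x y : K0_rel x y -> K0_rel y x
| K0_trans y x z : K0_rel x y -> K0_rel y z -> K0_rel x z
| K0_congrN x y : K0_rel x y -> K0_rel (K0_wordN x) (K0_wordN y)
| K0_congrD x x' y y' : K0_rel x x' -> K0_rel y y' ->
    K0_rel (K0_wordD x y) (K0_wordD x' y')
| K0_addA x y z :
    K0_rel (K0_wordD x (K0_wordD y z)) (K0_wordD (K0_wordD x y) z)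
| K0_addC x y : K0_rel (K0_wordD x y) (K0_wordD y x)
| K0_add0 x : K0_rel (K0_wordD K0_word0 x) x
| K0_addN x : K0_rel (K0_wordD (K0_wordN x) x) K0_word0
| K0_exact (X Y Z : A) (i : mor X Y) (p : mor Y Z) : is_ses i p ->
    K0_rel (K0_gen Y) (K0_wordD (K0_gen X) (K0_gen Z)).

Section K0.
Variable A : abelian_category.

HB.instance Definition _ := gen_eqMixin (K0_word A).
HB.instance Definition _ := gen_choiceMixin (K0_word A).

Definition K0_relb (x y : K0_word A) : bool := `[< K0_rel x y >].

Lemma K0_relb_refl : reflexive K0_relb.
Proof. by move=> x; apply/asboolP; exact: K0_refl. Qed.

Lemma K0_relb_sym : symmetric K0_relb.
Proof. by move=> x y; apply/idP/idP => /asboolP h; apply/asboolP; exact: K0_sym. Qed.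

Lemma K0_relb_trans : transitive K0_relb.
Proof.
by move=> y x z /asboolP h /asboolP k; apply/asboolP; exact: K0_trans h k.
Qed.

Canonical K0_equiv :=
  EquivRel K0_relb K0_relb_refl K0_relb_sym K0_relb_trans.

Definition K0 : Type := {eq_quot K0_equiv}.
HB.instance Definition _ := EqQuotient.on K0.
HB.instance Definition _ := Choice.on K0.

Lemma K0_eqP (x y : K0_word A) : K0_rel x y <-> \pi_K0 x = \pi_K0 y.
Proof. by split=> [h|/eqmodP/asboolP//]; apply/eqmodP/asboolP. Qed.

Lemma K0_repr (x : K0_word A) : K0_rel (repr (\pi_K0 x)) x.
Proof. by apply/K0_eqP; rewrite reprK. Qed.

Definition K0_zero : K0 := \pi_K0 K0_word0.
Definition K0_opp (x : K0) : K0 := \pi_K0 (K0_wordN (repr x)).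
Definition K0_add (x y : K0) : K0 := \pi_K0 (K0_wordD (repr x) (repr y)).

Lemma K0_oppE x : K0_opp (\pi_K0 x) = \pi_K0 (K0_wordN x).
Proof. by apply/K0_eqP; apply: K0_congrN; exact: K0_repr. Qed.

Lemma K0_addE x y : K0_add (\pi_K0 x) (\pi_K0 y) = \pi_K0 (K0_wordD x y).
Proof. by apply/K0_eqP; apply: K0_congrD; exact: K0_repr. Qed.

Lemma K0_addrA : associative K0_add.
Proof.
elim/quotW=> x; elim/quotW=> y; elim/quotW=> z.
rewrite (K0_addE y z) (K0_addE x y) !K0_addE.
by apply/K0_eqP; exact: K0_addA.
Qed.

Lemma K0_addrC : commutative K0_add.
Proof.
elim/quotW=> x; elim/quotW=> y; rewrite !K0_addE.
by apply/K0_eqP; exact: K0_addC.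
Qed.

Lemma K0_add0r : left_id K0_zero K0_add.
Proof.
by elim/quotW=> x; rewrite K0_addE; apply/K0_eqP; exact: K0_add0.
Qed.

Lemma K0_addNr : left_inverse K0_zero K0_opp K0_add.
Proof.
by elim/quotW=> x; rewrite K0_oppE K0_addE; apply/K0_eqP; exact: K0_addN.
Qed.

HB.instance Definition _ :=
  GRing.isZmodule.Build K0 K0_addrA K0_addrC K0_add0r K0_addNr.

Definition K0_class (E : A) : K0 := \pi_K0 (K0_gen E).

Lemma K0_class_ses (X Y Z : A) (i : mor X Y) (p : mor Y Z) :
  is_ses i p -> K0_class Y = K0_class X + K0_class Z.
Proof.
move=> ip; rewrite [RHS](_ : _ = K0_add (K0_class X) (K0_class Z)) //.
by rewrite K0_addE; apply/K0_eqP; exact: K0_exact ip.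
Qed.

End K0.

Record subobject (A : abelian_category) (E : A) := Subobject {
  sub_ob :> A;
  sub_map : mor sub_ob E;
  sub_monoP : is_mono sub_map
}.

Section Subobjects.
Variables (A : abelian_category) (E : A).

Lemma sub0_mono (f : mor (zero_ob A) E) : is_mono f.
Proof.
move=> W g h _; have [_ [k [_ kP]]] := @zero_obP A W.
by rewrite -(kP g I) -(kP h I).
Qed.

Lemma subT_mono : is_mono (idm E).
Proof. by move=> W g h; rewrite !comp1m. Qed.

Definition sub0 : subobject E := Subobject (@sub0_mono 0).
Definition subT : subobject E := Subobject subT_mono.

(* F = E as subobjects of E *)
Definition is_full (F : subobject E) := is_iso (sub_map F).

(* F is contained in G, and Q is (a choice of) the quotient G / F *)
Definition is_subquotient (F G : subobject E) (Q : A) :=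
  exists (j : mor F G) (q : mor G Q),
    sub_map G \oc j = sub_map F /\ is_cokernel j q.

End Subobjects.

Definition free_finitely_generated (G : zmodType) :=
  exists (n : nat) (f : {additive G -> 'rV[int]_n}), bijective f.

Section Gamma.
Variables (A : abelian_category) (G : zmodType) (cl : {additive K0 A -> G}).

Definition cl_ob (E : A) : G := cl (K0_class E).

Inductive Gamma_plus : G -> Prop :=
| Gamma_plus_cl (E : A) : Gamma_plus (cl_ob E)
| Gamma_plus_add a b : Gamma_plus a -> Gamma_plus b -> Gamma_plus (a + b).

Definition Gamma_le (a b : G) := Gamma_plus (b - a).
Definition Gamma_lt (a b : G) := Gamma_le a b /\ a <> b.

Definition finite_below := forall a, Gamma_plus a ->
  finite_set [set b | Gamma_lt 0 b /\ Gamma_lt b a].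

Variable R : realType.
Local Open Scope complex_scope.

(* e^(i pi phi) *)
Definition expipi (phi : R) : R[i] := cos (pi * phi) +i* sin (pi * phi).

Definition is_stability_function (Z : {additive G -> R[i]}) :=
  forall E : A, ~ is_zero E ->
    exists r phi : R, [/\ 0 < r, 0 < phi, phi <= 1
                        & Z (cl_ob E) = r%:C * expipi phi].

(* the components of Z = - d + i r *)
Definition stab_d (Z : G -> R[i]) (x : G) : R := - complex.Re (Z x).
Definition stab_r (Z : G -> R[i]) (x : G) : R := complex.Im (Z x).

Definition slope (Z : G -> R[i]) (E : A) : \bar R :=
  if stab_r Z (cl_ob E) == 0 then +oo%E
  else (stab_d Z (cl_ob E) / stab_r Z (cl_ob E))%:E.

Definition semistable (Z : G -> R[i]) (E : A) :=
  ~ is_zero E /\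
  forall F : subobject E, ~ is_zero F -> ~ is_full F ->
    (slope Z F <= slope Z E)%E.

(* The filtration 0 = E_0, E_1, ..., E_n = E is given by the list
   s = [:: E_1; ...; E_n], and Q i is E_(i+1) / E_i. *)
Definition is_HN_filtration (Z : G -> R[i]) (E : A) (s : seq (subobject E)) :=
  is_full (last (sub0 E) s) /\
  exists Q : nat -> A,
    (forall i, (i < size s)%N ->
       is_subquotient (nth (sub0 E) (sub0 E :: s) i) (nth (sub0 E) s i) (Q i)
       /\ semistable Z (Q i)) /\
    (forall i, (i.+1 < size s)%N -> (slope Z (Q i.+1) < slope Z (Q i))%E).

Definition HN_property (Z : G -> R[i]) :=
  forall E : A, exists s : seq (subobject E), is_HN_filtration Z s.

Definition is_framing_rank (v : {additive G -> int}) :=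
  forall E : A, 0 <= v (cl_ob E).

Definition is_compatible (v : {additive G -> int}) (Z : {additive G -> R[i]}) :=
  forall E : A, stab_r Z (cl_ob E) = 0 -> v (cl_ob E) = 0.

Definition stab_shift (Z : G -> R[i]) (v : G -> int) (c : R) (x : G) : R[i] :=
  Z x - (c * (v x)%:~R)%:C.

(* P holds with respect to c^+, resp. c^-: at c + e, resp. c - e, for all
   sufficiently small e > 0. *)
Definition at_plus (P : R -> Prop) (c : R) := \forall e \near 0^'+, P (c + e).
Definition at_minus (P : R -> Prop) (c : R) := \forall e \near 0^'+, P (c - e).

End Gamma.

(* Main.v *)
Require Import Defs.
From HB Require Import structures.
From mathcomp Require Import all_boot all_order all_algebra.
From mathcomp Require Import all_classical all_reals all_analysis.
From mathcomp Require Import complex.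
From mathcomp Require Import zify ring lra.

Set Implicit Arguments.
Unset Strict Implicit.
Unset Printing Implicit Defensive.

Import Order.TTheory GRing.Theory Num.Theory.
Import numFieldNormedType.Exports.

Local Open Scope classical_set_scope.
Local Open Scope ring_scope.
Local Open Scope complex_scope.

(** Write [d_t = d + t v], the degree for the stability function [Z_t]. The
    slope comparison of [X] and [Y] with respect to [Z_t] is the sign of
    [slope_det t X Y = d_t(X) r(Y) - d_t(Y) r(X)], which is additive in each
    class and affine in [t], with [t]-derivative [v(X) r(Y) - v(Y) r(X)]. Call
    [F] aligned with [E] if [slope_det c F E = 0].

    From (1) to (2) and (3). The classes of subobjects of [E] form a finite
    set, so for [t] close to [c] only aligned subobjects of a [c]-semistable
    object can destabilize it for [Z_t] ([destabilizing_aligned]). Since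
    [v(E) = 1], a subobject [F] of [E] has [v(F)] equal to 0 or 1. When [t < c]
    the aligned [F] with [v(F) = 0] are the ones that destabilize, so let [E']
    be an aligned subobject with [v(E') = 0] of maximal [r]. It is
    [t]-semistable for every [t], because [v] vanishes on it and on all its
    subobjects, while an aligned subobject of [E / E'] destabilizing it for
    [t < c] would have a preimage in [E] of larger [r]
    ([HN_left_of_wall]). Dually, when [t > c] let [E'] be an aligned subobject
    with [v(E') = 1] of minimal [r]: now [v(E / E') = 0], and a subobject
    destabilizing [E'] would contradict minimality ([HN_right_of_wall]). In
    both cases the slopes of [E'] and [E / E'] agree at [c] and separate in the
    right direction, so [E'] gives the Harder-Narasimhan filtration.

    From (2) or (3) to (1). Semistability is a closed condition on [t], so the
    factors [E'] and [E / E'] are [c]-semistable; they have the [c]-slope of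
    [E], and an extension of semistable objects of equal slope is
    semistable ([HN_limit], [semistable_extension]). *)

(** * Preadditive categories *)

Section Preadditive.
Variable A : preadditive_category.
Implicit Types X Y Z : A.

Lemma compm0 X Y Z (f : mor Y Z) : f \oc (0 : mor X Y) = 0.
Proof. by apply: (addrI (f \oc 0)); rewrite -compDr !addr0. Qed.

Lemma comp0m X Y Z (f : mor X Y) : (0 : mor Y Z) \oc f = 0.
Proof. by apply: (addrI (0 \oc f)); rewrite -compDl !addr0. Qed.

Lemma compmN X Y Z (g : mor Y Z) (f : mor X Y) : g \oc (- f) = - (g \oc f).
Proof. by apply: (addrI (g \oc f)); rewrite -compDr !subrr compm0. Qed.

Lemma is_zeroP X : is_zero X <-> idm X = 0.
Proof.
split=> [/(_ X)[[f [_ fP]] _]|X0 Y]; first by rewrite -(fP (idm X) I) -(fP 0 I).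
split; exists 0; split=> // f _.
  by rewrite -(compm1 f) X0 compm0.
by rewrite -(comp1m f) X0 comp0m.
Qed.

Lemma zero_src X Y (f : mor X Y) : is_zero X -> f = 0.
Proof. by move=> /is_zeroP X0; rewrite -(compm1 f) X0 compm0. Qed.

Lemma zero_tgt X Y (f : mor X Y) : is_zero Y -> f = 0.
Proof. by move=> /is_zeroP Y0; rewrite -(comp1m f) Y0 comp0m. Qed.

Lemma is_mono_eq0 X Y (f : mor X Y) :
  (forall W (g : mor W X), f \oc g = 0 -> g = 0) -> is_mono f.
Proof.
move=> f0 W g h gh; apply/subr0_eq/f0.
by rewrite compDr compmN gh subrr.
Qed.

Lemma mono_comp X Y Z (g : mor Y Z) (f : mor X Y) :
  is_mono g -> is_mono f -> is_mono (g \oc f).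
Proof. by move=> gm fm W a b; rewrite -!Defs.compA => /gm/fm. Qed.

Lemma epi_comp X Y Z (g : mor Y Z) (f : mor X Y) :
  is_epi g -> is_epi f -> is_epi (g \oc f).
Proof. by move=> ge fe W a b; rewrite !Defs.compA => /fe/ge. Qed.

Lemma kernel_mono K X Y (k : mor K X) (f : mor X Y) :
  is_kernel k f -> is_mono k.
Proof.
move=> [fk kP] W g h gh.
have [|u [_ uP]] := kP _ (k \oc g); first by rewrite Defs.compA fk comp0m.
by rewrite -(uP g)// -(uP h).
Qed.

Lemma cokernel_epi X Y Q (f : mor X Y) (q : mor Y Q) :
  is_cokernel f q -> is_epi q.
Proof.
move=> [qf qP] W g h gh.
have [|u [_ uP]] := qP _ (g \oc q); first by rewrite -Defs.compA qf compm0.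
by rewrite -(uP g)// -(uP h).
Qed.

Lemma iso_mono X Y (f : mor X Y) : is_iso f -> is_mono f.
Proof.
move=> [g [gf _]] W a b ab.
by rewrite -(comp1m a) -(comp1m b) -gf -!Defs.compA ab.
Qed.

Lemma iso_sym X Y (f : mor X Y) : is_iso f -> exists g : mor Y X, is_iso g.
Proof. by move=> [g [gf fg]]; exists g, f. Qed.

Lemma iso_zero X Y (f : mor X Y) : is_iso f -> is_zero X -> is_zero Y.
Proof.
move=> [g [gf fg]] X0; apply/is_zeroP.
by rewrite -fg (zero_tgt g X0) compm0.
Qed.

Lemma cokernel_unique X Y Q Q' (f : mor X Y) (q : mor Y Q) (q' : mor Y Q') :
  is_cokernel f q -> is_cokernel f q' -> exists h : mor Q Q', is_iso h.
Proof.
move=> cq cq'; have [qf /(_ _ q')] := cq; have [q'f /(_ _ q)] := cq'.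
move=> /(_ qf)[g [gq' _]] /(_ q'f)[h [hq _]].
exists h, g; split.
  by apply: (cokernel_epi cq); rewrite -Defs.compA hq gq' comp1m.
by apply: (cokernel_epi cq'); rewrite -Defs.compA gq' hq comp1m.
Qed.

Lemma cokernel_zero_src X Y (f : mor X Y) :
  is_zero X -> is_cokernel f (idm Y).
Proof.
move=> X0; split=> [|Z g _]; first exact: zero_src.
by exists g; split=> [|h]; rewrite compm1.
Qed.

Lemma ses_zero_tgt_iso X Y Z (i : mor X Y) (p : mor Y Z) :
  is_ses i p -> is_zero Z -> is_iso i.
Proof.
move=> [ki _] Z0; have [pi /(_ _ (idm Y))] := ki.
move=> /(_ (zero_tgt _ Z0))[h [ih _]].
by exists h; split=> //; apply: (kernel_mono ki); rewrite Defs.compA ih comp1m compm1.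
Qed.

End Preadditive.

(** * Exact sequences and images in abelian categories *)

Section Abelian.
Variable A : abelian_category.
Implicit Types X Y Z : A.

Lemma mono_ses X Y Q (f : mor X Y) (q : mor Y Q) :
  is_mono f -> is_cokernel f q -> is_ses f q.
Proof.
move=> fm cq; split=> //; have [qf qP] := cq.
have [Z [g [gf gP]]] := mono_normal fm.
split=> // W w qw; apply: gP.
by have [h [<- _]] := qP _ g gf; rewrite -Defs.compA qw compm0.
Qed.

Lemma epi_ses K Y Q (k : mor K Y) (q : mor Y Q) :
  is_epi q -> is_kernel k q -> is_ses k q.
Proof.
move=> qe kk; split=> //; have [qk kP] := kk.
have [Z [g [qg gP]]] := epi_conormal qe.
split=> // W w wk; apply: gP.
by have [h [<- _]] := kP _ g qg; rewrite Defs.compA wk comp0m.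
Qed.

Lemma iso_ses X Y N (f : mor X Y) :
  is_iso f -> is_zero N -> is_ses f (0 : mor Y N).
Proof.
move=> fi N0; apply: mono_ses; first exact: iso_mono.
have [g [_ fg]] := fi; split=> [|T u uf]; first exact: comp0m.
have -> : u = 0 by rewrite -(compm1 u) -fg Defs.compA uf comp0m.
by exists 0; split=> [|w _]; rewrite ?comp0m// (zero_src w).
Qed.

Lemma mono_has_quotient X Y (f : mor X Y) :
  is_mono f -> exists (Q : A) (q : mor Y Q), is_ses f q.
Proof.
move=> fm; have [Q [q cq]] := has_cokernels f.
by exists Q, q; exact: mono_ses.
Qed.

(** The coimage of [g] is its image. For [m] with [m \oc t = 0], the cokernel
    [q] of [t] gives an epimorphism [q \oc p] through which [g] factors. This
    epimorphism is the cokernel of some [h], which lands in [ker g] and is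
    therefore killed by [p]; hence [p] factors back through [q \oc p], which
    makes [q] split mono and [t] zero. *)
Lemma mono_epi_factorization X Y (g : mor X Y) :
  exists (K I : A) (k : mor K X) (p : mor X I) (m : mor I Y),
    [/\ is_kernel k g, is_ses k p, is_mono m & m \oc p = g].
Proof.
have [K [k kk]] := has_kernels g; have [I [p cp]] := has_cokernels k.
have [gk kP] := kk; have [pk pP] := cp; have pe := cokernel_epi cp.
have [m [mp _]] := pP _ g gk.
exists K, I, k, p, m; split=> //.
  by apply: mono_ses => //; exact: kernel_mono kk.
apply: is_mono_eq0 => T t mt.
have [D [q cq]] := has_cokernels t; have [qt qP] := cq.
have [m' [m'q _]] := qP _ m mt.
have qpe := epi_comp (cokernel_epi cq) pe.
have [W [h [qph hP]]] := epi_conormal qpe.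
have [|h' [kh' _]] := kP _ h.
  by rewrite -mp -m'q -!Defs.compA (Defs.compA q) qph compm0.
have [|s [sqp _]] := hP _ p; first by rewrite -kh' Defs.compA pk comp0m.
have sq : s \oc q = idm I by apply: pe; rewrite -Defs.compA sqp comp1m.
by rewrite -(comp1m t) -sq -Defs.compA qt compm0.
Qed.

End Abelian.

(** * Affine functions near a point and finite families *)

Section Reals.
Variable R : realType.

(** The bound holds for both signs of [t], so that the same estimate serves on
    either side of a wall. *)
Lemma near_right_affine_lt0 (x y : R) : x < 0 ->
  \forall e \near 0^'+, forall t, `|t| <= e -> x + t * y <= 0.
Proof.
move=> x0; have y1 : 0 < `|y| + 1 by rewrite ltr_wpDl.
have : 0 < - x / (`|y| + 1) by rewrite divr_gt0// oppr_gt0.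
move=> /nbhs_right_lt; apply: filterS => e.
rewrite ltr_pdivlMr// => ex t te.
have : t * y <= e * `|y|.
  by rewrite (le_trans (ler_norm _))// normrM ler_wpM2r.
have : 0 <= e by rewrite (le_trans _ te).
lra.
Qed.

Lemma near_right_affine_le0 (x y : R) :
  (\forall e \near 0^'+, x + e * y <= 0) -> x <= 0.
Proof.
move=> xy; rewrite leNgt; apply/negP => x0.
have Nx0 : - x < 0 by rewrite oppr_lt0.
(* The slope [1 - y] yields [e <= x + e * y], against [x + e * y <= 0]. *)
have [e [e0 [xye]]] := filter_ex (filterI (nbhs_right_gt 0)
  (filterI xy (near_right_affine_lt0 (1 - y) Nx0))).
move=> /(_ e); rewrite gtr0_norm// => /(_ (lexx _)).
have : 0 < e by []. lra.
Qed.

Lemma near_forall_mem (T : eqType) (s : seq T) (P : R -> T -> Prop) :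
  (forall x, \forall e \near 0^'+, P e x) ->
  \forall e \near 0^'+, forall x, x \in s -> P e x.
Proof.
move=> Px; elim: s => [|x s IHs]; first exact: nearW.
apply: filterS2 (Px x) IHs => e Pex Pes y.
by rewrite inE => /predU1P[->|/Pes].
Qed.

Lemma exists_argmax_mem (T : eqType) (s : seq T) (P : T -> Prop) (f : T -> R) :
  (exists2 x, x \in s & P x) ->
  exists2 x, P x & forall y, y \in s -> P y -> f y <= f x.
Proof.
elim: s => [[]//|a s IHs] [x0 x0s Px0].
have [[x xs Px]|noP] := pselect (exists2 x, x \in s & P x); last first.
  have Pa y : y \in a :: s -> P y -> y = a.
    by rewrite inE => /predU1P[//|ys Py]; case: noP; exists y.
  by exists x0 => // y yas Py; rewrite (Pa y)// (Pa x0).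
have [|m Pm mmax] := IHs; first by exists x.
have [[Pa fma]|ma] := pselect (P a /\ f m < f a).
  exists a => // y; rewrite inE => /predU1P[->//|ys Py].
  by rewrite (le_trans (mmax y ys Py))// ltW.
exists m => // y; rewrite inE => /predU1P[->|/mmax//] Pa.
by rewrite leNgt; apply/negP => fma; apply: ma.
Qed.

End Reals.

(** * Comparing slopes by a determinant *)

Section WallCrossing.
Variables (R : realType) (A : abelian_category) (G : zmodType).
Variables (cl : {additive K0 A -> G}) (v : {additive G -> int}).
Variable (Z : {additive G -> R[i]}).
Implicit Types (X Y Q E : A) (t : R).

Notation W := (stab_shift Z v).
Notation rk X := (stab_r Z (cl_ob cl X)).
Notation fr X := (v (cl_ob cl X)).
Notation deg t X := (stab_d (W t) (cl_ob cl X)).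

Lemma cl_ses X Y Q (i : mor X Y) (p : mor Y Q) :
  is_ses i p -> cl_ob cl Y = cl_ob cl X + cl_ob cl Q.
Proof. by move=> /K0_class_ses h; rewrite /cl_ob h raddfD. Qed.

Lemma cl_zero X : is_zero X -> cl_ob cl X = 0.
Proof.
move=> X0; have i1 : is_iso (idm X) by exists (idm X); rewrite comp1m.
by apply: (addrI (cl_ob cl X)); rewrite addr0 -(cl_ses (iso_ses i1 X0)).
Qed.

Lemma cl_iso X Y (f : mor X Y) : is_iso f -> cl_ob cl X = cl_ob cl Y.
Proof.
move=> fi; have z := @zero_obP A.
by rewrite (cl_ses (iso_ses fi z)) (cl_zero z) addr0.
Qed.

(** Clearing denominators in the comparison of slopes removes the infinite
    value and turns it into a function that is additive in [x] and affine in
    [t]. *)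
Definition slope_det t (x y : G) : R :=
  stab_d (W t) x * stab_r Z y - stab_d (W t) y * stab_r Z x.

Lemma stab_shift_r t x : stab_r (W t) x = stab_r Z x.
Proof. by rewrite /stab_r /stab_shift; case: (Z x) => a b /=; rewrite subr0. Qed.

Lemma stab_shift_d t x : stab_d (W t) x = stab_d Z x + t * (v x)%:~R.
Proof.
by rewrite /stab_d /stab_shift; case: (Z x) => a b /=; rewrite opprB addrC.
Qed.

Lemma stab_rD x y : stab_r Z (x + y) = stab_r Z x + stab_r Z y.
Proof. by rewrite /stab_r raddfD; case: (Z x) => ? ?; case: (Z y). Qed.

Lemma stab_shift_dD t x y :
  stab_d (W t) (x + y) = stab_d (W t) x + stab_d (W t) y.
Proof.
rewrite !stab_shift_d /stab_d !raddfD/=.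
by case: (Z x) => ? ?; case: (Z y) => ? ? /=; ring.
Qed.

Lemma slope_detD t x y z :
  slope_det t (x + y) z = slope_det t x z + slope_det t y z.
Proof. by rewrite /slope_det stab_shift_dD stab_rD; ring. Qed.

Lemma slope_detxx t x : slope_det t x x = 0.
Proof. exact: subrr. Qed.

Lemma slope_det0 t x : slope_det t 0 x = 0.
Proof. by apply: (addrI (slope_det t 0 x)); rewrite -slope_detD !addr0. Qed.

Lemma slope_det_shift c t x y :
  slope_det (c + t) x y = slope_det c x y +
    t * ((v x)%:~R * stab_r Z y - (v y)%:~R * stab_r Z x).
Proof. by rewrite /slope_det !stab_shift_d; ring. Qed.

Lemma slope_det_proportional t x y z :
  slope_det t x z = 0 ->
  slope_det t y x * stab_r Z z = slope_det t y z * stab_r Z x.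
Proof.
rewrite /slope_det => /subr0_eq h.
by rewrite mulrBl mulrBl [_ * _ * stab_r Z z]mulrAC
  [X in _ - X = _]mulrAC h; ring.
Qed.

Hypothesis Z_stab : is_stability_function cl Z.

Lemma rk_ge0 X : 0 <= rk X.
Proof.
have [/cl_zero ->|/Z_stab [r [phi [r0 p0 p1 ZX]]]] := pselect (is_zero X).
  by rewrite /stab_r raddf0.
rewrite /stab_r ZX /= mul0r addr0 mulr_ge0 ?(ltW r0)// sin_ge0_pi//.
by rewrite mulr_ge0 ?pi_ge0 ?(ltW p0)//= ger_pMr// pi_gt0.
Qed.

Lemma deg0_gt0 X : ~ is_zero X -> rk X = 0 -> 0 < stab_d Z (cl_ob cl X).
Proof.
move=> /Z_stab [r [phi [r0 p0 p1 ZX]]]; rewrite /stab_r /stab_d ZX /=.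
rewrite mul0r addr0 mul0r subr0 => /eqP; rewrite mulf_eq0 gt_eqF//= => sin0.
have -> : phi = 1.
  apply/eqP; rewrite eq_le p1 leNgt; apply/negP => p1'.
  have : 0 < sin (pi * phi) by rewrite sin_gt0_pi// mulr_gt0 ?pi_gt0//= gtr_pMr// pi_gt0.
  by rewrite (eqP sin0) ltxx.
by rewrite mulr1 cospi mulrN1 opprK.
Qed.

Hypothesis v_rank : is_framing_rank cl v.
Hypothesis Z_compat : is_compatible cl v Z.

Lemma deg_gt0 t X : ~ is_zero X -> rk X = 0 -> 0 < deg t X.
Proof.
by move=> X0 rX; rewrite stab_shift_d (Z_compat rX) mulr0 addr0 deg0_gt0.
Qed.

(** An object of rank 0 has positive degree, which is exactly what makes the
    sign of the determinant agree with the convention that its slope is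
    [+oo]. *)
Lemma slope_le t X Y : ~ is_zero X -> ~ is_zero Y ->
  (slope cl (W t) X <= slope cl (W t) Y)%E =
  (slope_det t (cl_ob cl X) (cl_ob cl Y) <= 0).
Proof.
move=> X0 Y0; rewrite /slope /slope_det !stab_shift_r.
have rX := rk_ge0 X; have rY := rk_ge0 Y.
have dX := deg_gt0 t X0; have dY := deg_gt0 t Y0.
have [Y1|Y1] := eqVneq (rk Y) 0.
  by rewrite leey Y1 mulr0 sub0r oppr_le0 mulr_ge0// ltW// dY.
have rY0 : 0 < rk Y by rewrite lt_def Y1.
have [X1|X1] := eqVneq (rk X) 0.
  by rewrite leye_eq X1 mulr0 subr0 pmulr_lle0// leNgt dX.
have rX0 : 0 < rk X by rewrite lt_def X1.
by rewrite lee_fin ler_pdivrMr// mulrAC ler_pdivlMr// subr_le0.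
Qed.

Lemma slope_eq t X Y : rk Y != 0 ->
  slope cl (W t) X = slope cl (W t) Y -> slope_det t (cl_ob cl X) (cl_ob cl Y) = 0.
Proof.
rewrite /slope /slope_det !stab_shift_r => Y0; rewrite (negbTE Y0).
have [//|X0 [] /eqP] := eqVneq (rk X) 0.
by rewrite eqr_div// => /eqP ->; rewrite subrr.
Qed.

Lemma eq_slope t X Y : rk X != 0 -> rk Y != 0 ->
  slope_det t (cl_ob cl X) (cl_ob cl Y) = 0 -> slope cl (W t) X = slope cl (W t) Y.
Proof.
rewrite /slope /slope_det !stab_shift_r => X0 Y0 /subr0_eq h.
rewrite (negbTE X0) (negbTE Y0); congr (_ %:E).
by apply/eqP; rewrite eqr_div// h.
Qed.

(** Zero and full subobjects satisfy the inequality with equality, so they may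
    be included among the tests. *)
Lemma semistableP t X : semistable cl (W t) X <->
  ~ is_zero X /\ forall Y (m : mor Y X), is_mono m ->
    slope_det t (cl_ob cl Y) (cl_ob cl X) <= 0.
Proof.
split=> -[X0 sX]; split=> //; last first => [F F0 _|Y m mm].
  by rewrite slope_le//; exact: sX (@sub_monoP _ _ F).
have [/cl_zero->|Y0] := pselect (is_zero Y); first by rewrite slope_det0.
have [/cl_iso->|mi] := pselect (is_iso m); first by rewrite slope_detxx.
by rewrite -slope_le//; apply: (sX (Subobject mm)).
Qed.

Lemma semistable_iso t X Y (f : mor X Y) :
  is_iso f -> semistable cl (W t) X -> semistable cl (W t) Y.
Proof.
move=> fi /semistableP[X0 sX]; have [g gi] := iso_sym fi.
apply/semistableP; split=> [/(iso_zero gi)//|T m mm].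
by rewrite -(cl_iso fi); apply: sX (mono_comp (iso_mono gi) mm).
Qed.

(** * Filtrations with one or two steps *)

Lemma HN1P t E :
  is_HN_filtration cl (W t) [:: subT E] <-> semistable cl (W t) E.
Proof.
split=> [[_ [Q [/(_ 0%N isT)[/= [j [q [_ cq]]] sQ] _]]]|sE].
  have [h hi] := cokernel_unique cq (cokernel_zero_src j (@zero_obP A)).
  exact: semistable_iso hi sQ.
split; first by exists (idm E); rewrite /= comp1m.
exists (fun=> E); split=> -[|i]//= _; split=> //.
exists 0, (idm E); split; first by rewrite compm0.
exact/cokernel_zero_src/(@zero_obP A).
Qed.

(** Quotients in a filtration are only given up to isomorphism; this
    characterization fixes one cokernel for all stability functions at once. *)
Lemma HN2P t E (F : subobject E) Q (q : mor E Q) : is_cokernel (Defs.sub_map F) q ->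
  is_HN_filtration cl (W t) [:: F; subT E] <->
  [/\ semistable cl (W t) F, semistable cl (W t) Q &
      0 < slope_det t (cl_ob cl F) (cl_ob cl Q)].
Proof.
move=> cq; have slt X Y : semistable cl (W t) X -> semistable cl (W t) Y ->
  (slope cl (W t) Y < slope cl (W t) X)%E =
  (0 < slope_det t (cl_ob cl X) (cl_ob cl Y)).
  by move=> [X0 _] [Y0 _]; rewrite !ltNge slope_le.
split.
  move=> [_ [P [sP /(_ 0%N isT)/= PP]]].
  have [/= [j0 [q0 [_ c0]]] s0] := sP 0%N isT.
  have [/= [j1 [q1 [jF c1]]] s1] := sP 1%N isT.
  rewrite comp1m in jF; rewrite {}jF in c1.
  have [h0 i0] := cokernel_unique c0 (cokernel_zero_src j0 (@zero_obP A)).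
  have [h1 i1] := cokernel_unique c1 cq.
  rewrite slt// in PP; split; [exact: semistable_iso i0 s0| |].
    exact: semistable_iso i1 s1.
  by rewrite -(cl_iso i0) -(cl_iso i1).
move=> [sF sQ FQ]; split; first by exists (idm E); rewrite /= comp1m.
exists (fun i => if i is 0%N then sub_ob F else Q).
split=> [[|[|i]]//= _|[|[|i]]//= _]; last by rewrite slt.
  split=> //; exists 0, (idm F); split; first by rewrite compm0.
  exact/cokernel_zero_src/(@zero_obP A).
by split=> //; exists (Defs.sub_map F), q; rewrite comp1m.
Qed.

(** * Semistable objects of a fixed slope *)

(** Every inequality that defines semistability is affine in the parameter,
    so it passes to a one-sided limit; the sign of [u] selects the side. *)
Lemma semistable_limit c (u : R) X :
  (\forall e \near 0^'+, semistable cl (W (c + u * e)) X) ->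
  semistable cl (W c) X.
Proof.
move=> sX; apply/semistableP; split=> [|Y m mm].
  by have [e []] := filter_ex sX.
apply: (@near_right_affine_le0 _ _
  (u * ((fr Y)%:~R * rk X - (fr X)%:~R * rk Y))).
apply: filterS sX => e /semistableP[_ /(_ _ _ mm)].
by rewrite slope_det_shift mulrCA mulrA (mulrC u).
Qed.

(** In rank 0 the determinant against [E] would be the positive number
    [d(X) r(E)]. *)
Lemma rk_aligned_gt0 t X E : 0 < rk E -> ~ is_zero X ->
  slope_det t (cl_ob cl X) (cl_ob cl E) = 0 -> 0 < rk X.
Proof.
move=> rE X0 XE; rewrite lt_def rk_ge0 andbT; apply/eqP => rX.
have := deg_gt0 t X0 rX; move: XE; rewrite /slope_det rX mulr0 subr0.
by move=> /eqP; rewrite mulf_eq0 (gt_eqF rE) orbF => /eqP ->; rewrite ltxx.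
Qed.

(** For objects of the slope of [E], subobjects can all be tested against the
    single additive function [slope_det t _ E], as in King stability. This is
    what makes sub-, quotient and extension arguments additive. *)
Lemma semistable_aligned t X E : 0 < rk E -> ~ is_zero X ->
  slope_det t (cl_ob cl X) (cl_ob cl E) = 0 ->
  semistable cl (W t) X <->
  forall Y (m : mor Y X), is_mono m -> slope_det t (cl_ob cl Y) (cl_ob cl E) <= 0.
Proof.
move=> rE X0 XE; have rX := rk_aligned_gt0 rE X0 XE.
have sgn Y : (slope_det t (cl_ob cl Y) (cl_ob cl X) <= 0) =
             (slope_det t (cl_ob cl Y) (cl_ob cl E) <= 0).
  have h := slope_det_proportional (cl_ob cl Y) XE.
  by rewrite -(pmulr_lle0 _ rE) h pmulr_lle0.
rewrite semistableP; split=> [[_ sX] Y m /sX|sX]; first by rewrite sgn.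
by split=> // Y m /sX; rewrite sgn.
Qed.

Lemma aligned_trans t x y z : 0 < stab_r Z z -> 0 < stab_r Z x ->
  slope_det t x z = 0 -> (slope_det t y x = 0 <-> slope_det t y z = 0).
Proof.
move=> rz rx /(slope_det_proportional y) h.
have [rz0 rx0] := (gt_eqF rz, gt_eqF rx).
split=> y0; move: h; rewrite y0 mul0r => /eqP.
  by rewrite eq_sym mulf_eq0 rx0 orbF => /eqP.
by rewrite mulf_eq0 rz0 orbF => /eqP.
Qed.

Lemma slope_det_quotient t F E Q (i : mor F E) (q : mor E Q) :
  is_ses i q -> slope_det t (cl_ob cl F) (cl_ob cl E) = 0 ->
  slope_det t (cl_ob cl Q) (cl_ob cl E) = 0.
Proof.
move=> sq FE.
by rewrite -[LHS]add0r -FE -slope_detD -(cl_ses sq) slope_detxx.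
Qed.

Lemma semistable_sub t F E (i : mor F E) : is_mono i -> 0 < rk E ->
  slope_det t (cl_ob cl F) (cl_ob cl E) = 0 -> ~ is_zero F ->
  semistable cl (W t) E -> semistable cl (W t) F.
Proof.
move=> im rE FE F0 /semistableP[_ sE].
by apply/(semistable_aligned rE F0 FE) => Y m mm; apply: sE (mono_comp im mm).
Qed.

(** The preimage of [Y] under [q] is the kernel of [E -> Q -> Q / Y], so its
    class can be read off from the three exact sequences around it. *)
Lemma sub_preimage F E Q Y (i : mor F E) (q : mor E Q) (m : mor Y Q) :
  is_ses i q -> is_mono m -> exists (P : A) (j : mor P E),
    is_mono j /\ cl_ob cl P = cl_ob cl F + cl_ob cl Y.
Proof.
move=> sq mm; have [C [r sr]] := mono_has_quotient mm.
have [P [j kj]] := has_kernels (r \oc q).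
exists P, j; split; first exact: kernel_mono kj.
have sj := epi_ses (epi_comp (cokernel_epi sr.2) (cokernel_epi sq.2)) kj.
apply: (addIr (cl_ob cl C)); rewrite -(cl_ses sj) (cl_ses sq) (cl_ses sr).
exact: addrA.
Qed.

Lemma semistable_quotient t F E Q (i : mor F E) (q : mor E Q) :
  is_ses i q -> 0 < rk E -> slope_det t (cl_ob cl F) (cl_ob cl E) = 0 ->
  ~ is_zero Q -> semistable cl (W t) E -> semistable cl (W t) Q.
Proof.
move=> sq rE FE Q0 /semistableP[_ sE].
have QE := slope_det_quotient sq FE.
apply/(semistable_aligned rE Q0 QE) => Y m mm.
have [P [j [jm Pcl]]] := sub_preimage sq mm.
by have := sE _ j jm; rewrite Pcl slope_detD FE add0r.
Qed.

(** A subobject [Y] of [E] is an extension of its image in [Q] by a subobject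
    of [F]. *)
Lemma semistable_extension t F E Q (i : mor F E) (q : mor E Q) :
  is_ses i q -> 0 < rk E -> slope_det t (cl_ob cl F) (cl_ob cl E) = 0 ->
  semistable cl (W t) F -> semistable cl (W t) Q -> semistable cl (W t) E.
Proof.
move=> sq rE FE sF sQ; have [F0 _] := sF; have [Q0 _] := sQ.
have QE := slope_det_quotient sq FE.
move: sF sQ => /(semistable_aligned rE F0 FE) sF /(semistable_aligned rE Q0 QE) sQ.
have E0 : ~ is_zero E by move=> /cl_zero E0; rewrite E0 /stab_r raddf0 ltxx in rE.
apply/(semistable_aligned rE E0 (slope_detxx _ _)) => Y m mm.
have [K [I [k [p [n [[gk _] skp nm gE]]]]]] := mono_epi_factorization (q \oc m).
rewrite (cl_ses skp) slope_detD.
have [|h [hE _]] := sq.1.2 _ (m \oc k); first by rewrite Defs.compA.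
have hm : is_mono h.
  move=> T a b ab; apply: (mono_comp mm (kernel_mono skp.1)).
  by rewrite -hE -!Defs.compA ab.
by have := sF _ h hm; have := sQ _ n nm; lra.
Qed.

(** * Framing rank and variation of the parameter *)

Lemma fr_mono Y X (m : mor Y X) : is_mono m -> 0 <= fr Y <= fr X.
Proof.
move=> /mono_has_quotient[Q [q /cl_ses ->]].
by rewrite v_rank raddfD lerDl v_rank.
Qed.

Lemma rk_mono Y X (m : mor Y X) : is_mono m -> 0 <= rk Y <= rk X.
Proof.
move=> /mono_has_quotient[Q [q /cl_ses ->]].
by rewrite rk_ge0 stab_rD lerDl rk_ge0.
Qed.

Lemma rk_gt0 X : fr X = 1 -> 0 < rk X.
Proof.
by move=> X1; rewrite lt_def rk_ge0 andbT; apply/eqP => /Z_compat; rewrite X1.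
Qed.

(** The framing rank vanishes on all subobjects too, so that the shift of
    parameter leaves every test unchanged. *)
Lemma semistable_unframed t t' X :
  fr X = 0 -> semistable cl (W t) X -> semistable cl (W t') X.
Proof.
move=> X0 /semistableP[Xn sX]; apply/semistableP; split=> // Y m mm.
have Y0 : fr Y = 0 by have := fr_mono mm; rewrite X0 -eq_le => /eqP.
by rewrite -(subrK t t') addrC slope_det_shift X0 Y0 !mul0r subrr mulr0 addr0 (sX _ m).
Qed.

Hypothesis fin_below : finite_below cl.

(** The finiteness assumption covers classes strictly between 0 and that of
    [E]; the two extreme classes are added by hand. *)
Lemma sub_classes_finite E : exists s : seq G,
  forall Y (m : mor Y E), is_mono m -> cl_ob cl Y \in s.
Proof.
have /finite_seqP[s sE] := fin_below (Gamma_plus_cl cl E).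
exists [:: 0, cl_ob cl E & s] => Y m /mono_has_quotient[Q [q /cl_ses EYQ]].
rewrite !inE; have [//|Y0] := eqVneq; have [//|YE] := eqVneq; rewrite /=.
suff : [set` s] (cl_ob cl Y) by [].
rewrite -sE /=; split; split; try exact: nesym (elimN eqP Y0).
- by rewrite /Gamma_le subr0; exact: Gamma_plus_cl.
- by rewrite /Gamma_le EYQ addrC addKr; exact: Gamma_plus_cl.
- exact/eqP.
Qed.

Lemma exists_max_sub E (P : G -> Prop) (f : G -> R) :
  (exists F : subobject E, P (cl_ob cl F)) ->
  exists F : subobject E, P (cl_ob cl F) /\
    forall Y (m : mor Y E), is_mono m -> P (cl_ob cl Y) ->
      f (cl_ob cl Y) <= f (cl_ob cl F).
Proof.
move=> [F0 PF0]; have [s sE] := sub_classes_finite E.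
have [|x [Px [F Fx]] xmax] := @exists_argmax_mem R G s
  (fun x => P x /\ exists F : subobject E, cl_ob cl F = x) f.
  exists (cl_ob cl F0); last by split=> //; exists F0.
  exact: sE (@sub_monoP _ _ F0).
exists F; rewrite Fx; split=> // Y m mm PY; apply: xmax; first exact: sE mm.
by split=> //; exists (Subobject mm).
Qed.

(** A subobject of strictly smaller [c]-slope stays so for nearby parameters,
    and the finiteness of the set of classes makes this uniform. *)
Lemma destabilizing_aligned c X : semistable cl (W c) X ->
  \forall e \near 0^'+, forall t, `|t| <= e -> forall Y (m : mor Y X),
    is_mono m -> 0 < slope_det (c + t) (cl_ob cl Y) (cl_ob cl X) ->
    slope_det c (cl_ob cl Y) (cl_ob cl X) = 0.
Proof.
move=> /semistableP[_ sX]; have [s sE] := sub_classes_finite X.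
have near_s : \forall e \near 0^'+, forall x, x \in s ->
    slope_det c x (cl_ob cl X) < 0 ->
    forall t, `|t| <= e -> slope_det (c + t) x (cl_ob cl X) <= 0.
  apply: near_forall_mem => x.
  have [x0|x0] := pselect (slope_det c x (cl_ob cl X) < 0); last exact: nearW.
  apply: filterS (near_right_affine_lt0
    ((v x)%:~R * rk X - (fr X)%:~R * stab_r Z x) x0) => e he _ t te.
  by rewrite slope_det_shift he.
apply: filterS near_s => e he t te Y m mm; rewrite ltNge => /negP YX.
apply/eqP; rewrite eq_le (sX _ m mm) leNgt; apply/negP => Y0.
by apply: YX; apply: he => //; exact: sE mm.
Qed.

(** * Harder-Narasimhan filtrations on the two sides of a wall *)

(** If [F] is neither zero nor full, both factors are semistable up to the
    limit and [E] is their extension; otherwise [E] itself is semistable for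
    the nearby parameters, whichever of the two forms the filtration takes. *)
Lemma HN_limit c u E (F : subobject E) :
  0 < rk E ->
  (~ is_zero F -> slope_det c (cl_ob cl F) (cl_ob cl E) = 0) ->
  (\forall e \near 0^'+,
     ((is_zero F \/ is_full F) /\
        is_HN_filtration cl (W (c + u * e)) [:: subT E])
     \/ is_HN_filtration cl (W (c + u * e)) [:: F; subT E]) ->
  semistable cl (W c) E.
Proof.
move=> rE FE HN; have [Q [q sq]] := mono_has_quotient (@sub_monoP _ _ F).
have HNP e := HN2P (c + u * e) sq.2.
have [F0|F0] := pselect (is_zero F).
  apply: (@semistable_limit c u); apply: filterS HN => e.
  by case=> [[_ /HN1P]|/HNP[[]]].
have [Ff|Ff] := pselect (is_full F).
  apply: (@semistable_limit c u); apply: filterS HN => e.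
  by case=> [[_ /HN1P]//|/HNP[/(semistable_iso Ff)]].
apply: (semistable_extension sq rE (FE F0)).
  apply: (@semistable_limit c u); apply: filterS HN => e.
  by case=> [[[]]//|/HNP[]].
apply: (@semistable_limit c u); apply: filterS HN => e.
by case=> [[[]]//|/HNP[]].
Qed.

(** The witness is an aligned subobject of framing rank 0 of maximal rank. *)
Lemma HN_left_of_wall c E : fr E = 1 -> semistable cl (W c) E ->
  exists F : subobject E,
    [/\ at_minus (fun a =>
          (is_zero F /\ is_HN_filtration cl (W a) [:: subT E])
          \/ is_HN_filtration cl (W a) [:: F; subT E]) c,
        fr F = 0
      & ~ is_zero F -> slope cl (W c) F = slope cl (W c) E].
Proof.
move=> E1 sE; have rE := rk_gt0 E1.
have [|F [[F0 FE] Fmax]] := @exists_max_sub E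
  (fun x => v x = 0 /\ slope_det c x (cl_ob cl E) = 0) (stab_r Z).
  by exists (sub0 E); rewrite cl_zero ?raddf0 ?slope_det0//; exact: (@zero_obP A).
have [Q [q sq]] := mono_has_quotient (@sub_monoP _ _ F).
have clE := cl_ses sq.
have Q1 : fr Q = 1 by rewrite -E1 clE raddfD F0 add0r.
have rQ := rk_gt0 Q1.
have Q0 : ~ is_zero Q by move=> /cl_zero Q0; move: Q1; rewrite Q0 raddf0.
have QE := slope_det_quotient sq FE.
have sQ := semistable_quotient sq rE FE Q0 sE.
have near_sQ : \forall e \near 0^'+, semistable cl (W (c - e)) Q.
  apply: filterS2 (nbhs_right_gt 0) (destabilizing_aligned sQ) => e e0 he.
  apply/semistableP; split=> // Y m mm; rewrite leNgt; apply/negP => YQ.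
  have YQ0 : slope_det c (cl_ob cl Y) (cl_ob cl Q) = 0.
    by apply: he mm YQ; rewrite normrN gtr0_norm.
  have /andP[rY rYQ] := rk_mono mm; have /andP[vY vYQ] := fr_mono mm.
  move: YQ; rewrite slope_det_shift YQ0 add0r Q1 mul1r mulNr oppr_gt0.
  rewrite pmulr_rlt0// subr_lt0 => vr.
  have Y0 : fr Y = 0.
    have [//|Y1] := eqVneq (fr Y) 0; have Y1' : fr Y = 1 by lia.
    by move: vr; rewrite Y1' mul1r ltNge rYQ.
  (* The preimage of [Y] competes with [F], and its rank is larger. *)
  have [P [j [jm clP]]] := sub_preimage sq mm.
  have := Fmax _ j jm; rewrite clP raddfD stab_rD slope_detD F0 Y0 FE.
  have -> : slope_det c (cl_ob cl Y) (cl_ob cl E) = 0.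
    exact/(aligned_trans _ rE rQ QE).
  rewrite !addr0 => /(_ (conj erefl erefl)).
  by rewrite gerDl leNgt; move: vr; rewrite Y0 mul0r => ->.
exists F; split=> //; last first.
  move=> Fn; apply: eq_slope => //; rewrite gt_eqF//.
  exact: rk_aligned_gt0 rE Fn FE.
have [Fz|Fn] := pselect (is_zero F).
  have [h hi] := cokernel_unique sq.2 (cokernel_zero_src _ Fz).
  apply: filterS near_sQ => e se; left; split=> //.
  exact/HN1P/(semistable_iso hi).
have rF := rk_aligned_gt0 rE Fn FE.
have FQ : slope_det c (cl_ob cl F) (cl_ob cl Q) = 0.
  exact/(aligned_trans _ rE rQ QE).
have sF := semistable_sub (@sub_monoP _ _ F) rE FE Fn sE.
apply: filterS2 (nbhs_right_gt 0) near_sQ => e e0 se; right.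
apply/(HN2P _ sq.2); split=> //; first exact: semistable_unframed sF.
rewrite slope_det_shift FQ F0 Q1 mul0r mul1r !add0r mulrNN.
exact: mulr_gt0.
Qed.

(** The witness is an aligned subobject of framing rank 1 of minimal rank. *)
Lemma HN_right_of_wall c E : fr E = 1 -> semistable cl (W c) E ->
  exists F : subobject E,
    [/\ at_plus (fun a =>
          (is_full F /\ is_HN_filtration cl (W a) [:: subT E])
          \/ is_HN_filtration cl (W a) [:: F; subT E]) c,
        fr F = 1
      & slope cl (W c) F = slope cl (W c) E].
Proof.
move=> E1 sE; have rE := rk_gt0 E1.
have [|F [[F1 FE] Fmin]] := @exists_max_sub E
  (fun x => v x = 1 /\ slope_det c x (cl_ob cl E) = 0) (fun x => - stab_r Z x).
  by exists (subT E); rewrite slope_detxx.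
have [Q [q sq]] := mono_has_quotient (@sub_monoP _ _ F).
have clE := cl_ses sq; have rF := rk_gt0 F1.
have Fn : ~ is_zero F by move=> /cl_zero F0; move: F1; rewrite F0 raddf0.
have Q0 : fr Q = 0 by apply: (addrI (fr F)); rewrite -raddfD -clE E1 F1.
have sF := semistable_sub (@sub_monoP _ _ F) rE FE Fn sE.
have near_sF : \forall e \near 0^'+, semistable cl (W (c + e)) F.
  apply: filterS2 (nbhs_right_gt 0) (destabilizing_aligned sF) => e e0 he.
  apply/semistableP; split=> // Y m mm; rewrite leNgt; apply/negP => YF.
  have YF0 : slope_det c (cl_ob cl Y) (cl_ob cl F) = 0.
    by apply: he mm YF; rewrite gtr0_norm.
  have /andP[rY rYF] := rk_mono mm; have /andP[vY vYF] := fr_mono mm.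
  move: YF; rewrite slope_det_shift YF0 add0r F1 mul1r.
  rewrite pmulr_rgt0// subr_gt0 => vr.
  have Y1 : fr Y = 1.
    have [Y0|Y1] := eqVneq (fr Y) 0; last by lia.
    by move: vr; rewrite Y0 mul0r ltNge rY.
  (* [Y] competes with [F], and its rank is smaller. *)
  have := Fmin _ _ (mono_comp (@sub_monoP _ _ F) mm).
  have -> : slope_det c (cl_ob cl Y) (cl_ob cl E) = 0.
    exact/(aligned_trans _ rE rF FE).
  move=> /(_ (conj Y1 erefl)).
  by rewrite lerN2 leNgt; move: vr; rewrite Y1 mul1r => ->.
exists F; split=> //; last by apply: eq_slope => //; rewrite gt_eqF.
have [Qz|Qn] := pselect (is_zero Q).
  have Ff := ses_zero_tgt_iso sq Qz.
  apply: filterS near_sF => e se; left; split=> //.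
  exact/HN1P/(semistable_iso Ff).
have QE := slope_det_quotient sq FE.
have rQ := rk_aligned_gt0 rE Qn QE.
have FQ : slope_det c (cl_ob cl F) (cl_ob cl Q) = 0.
  exact/(aligned_trans _ rE rQ QE).
have sQ := semistable_quotient sq rE FE Qn sE.
apply: filterS2 (nbhs_right_gt 0) near_sF => e e0 se; right.
apply/(HN2P _ sq.2); split=> //; first exact: semistable_unframed sQ.
rewrite slope_det_shift FQ F1 Q0 mul0r mul1r add0r subr0.
exact: mulr_gt0.
Qed.

End WallCrossing.

Theorem proposition3p9 (R : realType) (A : abelian_category) (G : zmodType)
    (cl : {additive K0 A -> G})
    (G_free : free_finitely_generated G)
    (fin_below : finite_below cl)
    (v : {additive G -> int}) (v_rank : is_framing_rank cl v)
    (Z : {additive G -> R[i]}) (Z_stab : is_stability_function cl Z)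
    (Z_compat : is_compatible cl v Z)
    (Z_HN : forall c : R, HN_property cl (stab_shift Z v c))
    (c : R) (E : A) (vE : v (cl_ob cl E) = 1) :
  [<-> semistable cl (stab_shift Z v c) E;

       exists E' : subobject E,
         [/\ at_minus (fun a =>
               (is_zero E' /\
                  is_HN_filtration cl (stab_shift Z v a) [:: subT E])
               \/ is_HN_filtration cl (stab_shift Z v a) [:: E'; subT E]) c,
             v (cl_ob cl E') = 0
           & ~ is_zero E' ->
             slope cl (stab_shift Z v c) E' = slope cl (stab_shift Z v c) E];

       exists E' : subobject E,
         [/\ at_plus (fun a =>
               (is_full E' /\
                  is_HN_filtration cl (stab_shift Z v a) [:: subT E])
               \/ is_HN_filtration cl (stab_shift Z v a) [:: E'; subT E]) c,
             v (cl_ob cl E') = 1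
           & slope cl (stab_shift Z v c) E' = slope cl (stab_shift Z v c) E]].
Proof.
have rE := rk_gt0 Z_stab Z_compat vE.
have rE0 : stab_r Z (cl_ob cl E) != 0 by rewrite gt_eqF.
tfae.
- exact: HN_left_of_wall.
- move=> [F [HN _ FE]]; apply: HN_right_of_wall => //.
  apply: (HN_limit (u := -1) (F := F) Z_stab Z_compat rE).
    by move=> /FE/slope_eq; apply.
  by apply: filterS HN => e; rewrite mulN1r => -[[]|]; [left; split; [left|]|right].
- move=> [F [HN _ FE]].
  apply: (HN_limit (u := 1) (F := F) Z_stab Z_compat rE).
    by move=> _; apply: slope_eq FE.
  by apply: filterS HN => e; rewrite mul1r => -[[]|]; [left; split; [right|]|right].
Qed.
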